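(* Let $\mathcal{K}_1$ be a consistent $\mathcal{ALC}$ knowledge base, $\mathcal{K}_2$ a consistent Horn-$\mathcal{ALC}$ knowledge base, and $\Sigma$ a signature. Then $\mathcal{K}_1$ $\Sigma$-UCQ entails $\mathcal{K}_2$ if and only if $\mathcal{K}_1$ $\Sigma$-CQ entails $\mathcal{K}_2$. Likewise, $\mathcal{K}_1$ $\Sigma$-rUCQ entails $\mathcal{K}_2$ if and only if $\mathcal{K}_1$ $\Sigma$-rCQ entails $\mathcal{K}_2$. The same two equivalences hold for TBox entailment: for an $\mathcal{ALC}$ TBox $\mathcal{T}_1$, a Horn-$\mathcal{ALC}$ TBox $\mathcal{T}_2$ and a pair of signatures $\Theta=(\Sigma_1,\Sigma_2)$, $\mathcal{T}_1$ $\Theta$-UCQ entails $\mathcal{T}_2$ iff $\mathcal{T}_1$ $\Theta$-CQ entails $\mathcal{T}_2$, and $\mathcal{T}_1$ $\Theta$-rUCQ entails $\mathcal{T}_2$ iff $\mathcal{T}_1$ $\Theta$-rCQ entails $\mathcal{T}_2$.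
   Context: $\mathcal{ALC}$ concepts are built from concept names $A$ and $\top$ using $\neg C$, $C_1\sqcap C_2$ and $\exists R.C$ ($R$ a role name); $\bot,\sqcup,\forall R.C$ are the usual abbreviations. A TBox is a finite set of concept inclusions $C\sqsubseteq D$. A TBox is Horn-$\mathcal{ALC}$ if no concept of the form $\neg C$ occurs negatively and no concept of the form $\exists R.\neg C$ occurs positively in it. An ABox is a finite set of assertions $A(a)$, $R(a,b)$ with individual names $a,b$; $\mathsf{ind}(\mathcal{A})$ is its set of individuals. A knowledge base (KB) is $\mathcal{K}=(\mathcal{T},\mathcal{A})$ with $\mathsf{ind}(\mathcal{K})=\mathsf{ind}(\mathcal{A})$; it is Horn-$\mathcal{ALC}$ if $\mathcal{T}$ is. Interpretations satisfy the standard name assumption $a^{\mathcal{I}}=a$. A conjunctive query (CQ) $q(\vec x)=\exists\vec y\,\varphi(\vec x,\vec y)$ with $\varphi$ a conjunction of atoms $A(z)$, $R(z,z')$ over variables in $\vec x,\vec y$; $\vec x$ are the answer variables. It is rooted (rCQ) if every $y\in\vec y$ is connected to some answer variable in the undirected graph whose edges are $\{u,v\}$ with $R(u,v)$ in $q$. A UCQ is a disjunction of CQs with the same answer variables; an rUCQ is a UCQ all of whose disjuncts are rooted. $\mathcal{K}\models q(\vec a)$ means $\mathcal{I}\models q(\vec a)$ for every model $\mathcal{I}$ of $\mathcal{K}$. A signature is a set of concept and role names; a $\Sigma$-query uses only symbols in $\Sigma$. For consistent KBs $\mathcal{K}_1,\mathcal{K}_2$ and a class $\mathcal{Q}\in\{$CQ,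 rCQ, UCQ, rUCQ$\}$, $\mathcal{K}_1$ $\Sigma$-$\mathcal{Q}$ entails $\mathcal{K}_2$ if for every $\Sigma$-query $q(\vec x)$ in $\mathcal{Q}$ and every tuple $\vec a$ from $\mathsf{ind}(\mathcal{K}_2)$, $\mathcal{K}_2\models q(\vec a)$ implies $\vec a\subseteq\mathsf{ind}(\mathcal{K}_1)$ and $\mathcal{K}_1\models q(\vec a)$. For TBoxes $\mathcal{T}_1,\mathcal{T}_2$ and $\Theta=(\Sigma_1,\Sigma_2)$, $\mathcal{T}_1$ $\Theta$-$\mathcal{Q}$ entails $\mathcal{T}_2$ if for every ABox $\mathcal{A}$ using only symbols from $\Sigma_1$ that is consistent with both $\mathcal{T}_1$ and $\mathcal{T}_2$, the KB $(\mathcal{T}_1,\mathcal{A})$ $\Sigma_2$-$\mathcal{Q}$ entails $(\mathcal{T}_2,\mathcal{A})$. *)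

(* Defs.v *)
From Stdlib Require Import List Relations.
Import ListNotations.

(* Each kind of name ranges over its own countably infinite supply. *)
Definition cname := nat.
Definition rname := nat.
Definition iname := nat.
Definition var := nat.

Inductive concept : Type :=
| CName (A : cname)
| CTop
| CNot (C : concept)
| CAnd (C1 C2 : concept)
| CEx (R : rname) (C : concept).

Record inclusion : Type := Incl { lhs : concept; rhs : concept }.
Definition tbox : Type := list inclusion.

Inductive assertion : Type :=
| AConcept (A : cname) (a : iname)
| ARole (R : rname) (a b : iname).
Definition abox : Type := list assertion.

Record kb : Type := KB { kb_tbox : tbox; kb_abox : abox }.

Definition inds_assertion (s : assertion) : list iname :=
  match s with AConcept _ a => [a] | ARole _ a b => [a; b] end.
Definition inds_abox (A : abox) : list iname := flat_map inds_assertion A.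
Definition inds_kb (K : kb) : list iname := inds_abox (kb_abox K).

(* The standard name assumption [a^I = a] says that the individual names are
   elements of the domain; here they are embedded injectively into it. *)
Record interp : Type := Interp {
  dom : Type;
  iind : iname -> dom;
  iind_inj : forall a b, iind a = iind b -> a = b;
  icon : cname -> dom -> Prop;
  irole : rname -> dom -> dom -> Prop
}.

Fixpoint ext (I : interp) (C : concept) (d : dom I) : Prop :=
  match C with
  | CName A => icon I A d
  | CTop => True
  | CNot C => ~ ext I C d
  | CAnd C1 C2 => ext I C1 d /\ ext I C2 d
  | CEx R C => exists e, irole I R d e /\ ext I C e
  end.

Definition sat_inclusion (I : interp) (i : inclusion) : Prop :=
  forall d, ext I (lhs i) d -> ext I (rhs i) d.

Definition sat_assertion (I : interp) (s : assertion) : Prop :=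
  match s with
  | AConcept A a => icon I A (iind I a)
  | ARole R a b => irole I R (iind I a) (iind I b)
  end.

Definition model (I : interp) (K : kb) : Prop :=
  Forall (sat_inclusion I) (kb_tbox K) /\ Forall (sat_assertion I) (kb_abox K).

Definition consistent (K : kb) : Prop := exists I, model I K.

Inductive polarity : Set := Pos | Neg.
Definition flip (p : polarity) : polarity :=
  match p with Pos => Neg | Neg => Pos end.

(* [occurs C p D]: [C] occurs in [D] with polarity [p]. *)
Inductive occurs (C : concept) : polarity -> concept -> Prop :=
| occurs_self : occurs C Pos C
| occurs_not p D : occurs C p D -> occurs C (flip p) (CNot D)
| occurs_andl p D E : occurs C p D -> occurs C p (CAnd D E)
| occurs_andr p D E : occurs C p E -> occurs C p (CAnd D E)
| occurs_ex p R D : occurs C p D -> occurs C p (CEx R D).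

(* Left-hand sides of inclusions reverse polarity. *)
Definition occurs_in_tbox (C : concept) (p : polarity) (T : tbox) : Prop :=
  exists i, In i T /\ (occurs C (flip p) (lhs i) \/ occurs C p (rhs i)).

(* Bottom, disjunction and value restriction are abbreviations, so occurrences
   are counted after unfolding them.  In particular a value restriction on a
   right-hand side is excluded, being [CNot (CEx R (CNot C))]. *)
Definition horn (T : tbox) : Prop :=
  (forall C, ~ occurs_in_tbox (CNot C) Neg T) /\
  (forall R C, ~ occurs_in_tbox (CEx R (CNot C)) Pos T).

Record signature : Type := Sig {
  sig_c : cname -> Prop;
  sig_r : rname -> Prop
}.

Definition abox_over (S : signature) (A : abox) : Prop :=
  Forall (fun s => match s with
                   | AConcept A _ => sig_c S A
                   | ARole R _ _ => sig_r S R
                   end) A.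

Inductive atom : Type :=
| QConcept (A : cname) (z : var)
| QRole (R : rname) (z z' : var).

Definition atom_vars (t : atom) : list var :=
  match t with QConcept _ z => [z] | QRole _ z z' => [z; z'] end.

Definition atom_over (S : signature) (t : atom) : Prop :=
  match t with
  | QConcept A _ => sig_c S A
  | QRole R _ _ => sig_r S R
  end.

Definition sat_atom (I : interp) (s : var -> dom I) (t : atom) : Prop :=
  match t with
  | QConcept A z => icon I A (s z)
  | QRole R z z' => irole I R (s z) (s z')
  end.

Record cq : Type := CQ {
  ans_vars : list var;
  ex_vars : list var;
  atoms : list atom
}.

Definition wf_cq (q : cq) : Prop :=
  NoDup (ans_vars q ++ ex_vars q) /\
  Forall (fun t => incl (atom_vars t) (ans_vars q ++ ex_vars q)) (atoms q).

Definition cq_over (S : signature) (q : cq) : Prop :=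
  Forall (atom_over S) (atoms q).

Definition cq_holds (I : interp) (q : cq) (a : list iname) : Prop :=
  exists s : var -> dom I,
    map s (ans_vars q) = map (iind I) a /\ Forall (sat_atom I s) (atoms q).

Definition edge (q : cq) (u v : var) : Prop :=
  exists R, In (QRole R u v) (atoms q).

Definition connected (q : cq) : var -> var -> Prop :=
  clos_refl_sym_trans var (edge q).

Definition rooted (q : cq) : Prop :=
  forall y, In y (ex_vars q) ->
    exists x, In x (ans_vars q) /\ connected q y x.

Record ucq : Type := UCQ {
  uans_vars : list var;
  disjuncts : list cq
}.

Definition wf_ucq (q : ucq) : Prop :=
  disjuncts q <> [] /\
  Forall (fun p => wf_cq p /\ ans_vars p = uans_vars q) (disjuncts q).

Definition ucq_over (S : signature) (q : ucq) : Prop :=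
  Forall (cq_over S) (disjuncts q).

Definition ucq_holds (I : interp) (q : ucq) (a : list iname) : Prop :=
  Exists (fun p => cq_holds I p a) (disjuncts q).

Definition urooted (q : ucq) : Prop := Forall rooted (disjuncts q).

Record query_class : Type := QueryClass {
  query : Type;
  in_class : query -> Prop;
  query_over : signature -> query -> Prop;
  query_ans : query -> list var;
  query_holds : interp -> query -> list iname -> Prop
}.

Definition class_CQ : query_class :=
  QueryClass cq wf_cq cq_over ans_vars cq_holds.
Definition class_rCQ : query_class :=
  QueryClass cq (fun q => wf_cq q /\ rooted q) cq_over ans_vars cq_holds.
Definition class_UCQ : query_class :=
  QueryClass ucq wf_ucq ucq_over uans_vars ucq_holds.
Definition class_rUCQ : query_class :=
  QueryClass ucq (fun q => wf_ucq q /\ urooted q) ucq_over uans_vars ucq_holds.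

Definition certain (Q : query_class) (K : kb) (q : query Q) (a : list iname)
    : Prop :=
  forall I, model I K -> query_holds Q I q a.

Definition kb_entails (Q : query_class) (S : signature) (K1 K2 : kb) : Prop :=
  forall (q : query Q) (a : list iname),
    in_class Q q -> query_over Q S q ->
    length a = length (query_ans Q q) ->
    incl a (inds_kb K2) ->
    certain Q K2 q a ->
    incl a (inds_kb K1) /\ certain Q K1 q a.

Definition tbox_entails (Q : query_class) (S1 S2 : signature) (T1 T2 : tbox)
    : Prop :=
  forall A : abox,
    abox_over S1 A -> consistent (KB T1 A) -> consistent (KB T2 A) ->
    kb_entails Q S2 (KB T1 A) (KB T2 A).

(* Main.v *)
(** Models of a Horn TBox are closed under direct products: a left-hand side is
    negation-free, so it is preserved by the two projections, while a right-hand
    side negates only negation-free concepts, so it holds at a pair as soon as it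
    holds at both components.  Conjunctive queries are preserved by the projections
    as well.  Hence, if a Horn knowledge base entails no disjunct of a UCQ, the
    product of countermodels for the disjuncts refutes the whole UCQ. *)

From Stdlib Require Import List Classical.
Require Import Defs.
Import ListNotations.

Record homomorphism (I J : interp) (h : dom I -> dom J) : Prop := {
  hom_ind : forall a, h (iind I a) = iind J a;
  hom_con : forall A d, icon I A d -> icon J A (h d);
  hom_role : forall R d e, irole I R d e -> irole J R (h d) (h e)
}.

(** An outermost negation always occurs positively, so the hypothesis leaves no negation in [C] at
    all. What remains is built from positive existential constructors, which homomorphisms
    preserve. *)
Lemma hom_ext_negation_free (I J : interp) (h : dom I -> dom J) (C : concept) :
  homomorphism I J h -> (forall D, ~ occurs (CNot D) Pos C) ->
  forall d, ext I C d -> ext J C (h d).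
Proof.
  intros Hh.
  induction C as [A | | C IH | C1 IH1 C2 IH2 | R C IH]; simpl; intros HC d.
  - apply (hom_con _ _ _ Hh).
  - trivial.
  - destruct (HC C). constructor.
  - intros [H1 H2]. split.
    + apply IH1; [|assumption]. intros D HD. apply (HC D). now constructor.
    + apply IH2; [|assumption]. intros D HD. apply (HC D). now constructor.
  - intros [e [He HCe]]. exists (h e). split.
    + now apply (hom_role _ _ _ Hh).
    + apply IH; [|assumption]. intros D HD. apply (HC D). now constructor.
Qed.

Lemma hom_cq_holds (I J : interp) (h : dom I -> dom J) (q : cq) (a : list iname) :
  homomorphism I J h -> cq_holds I q a -> cq_holds J q a.
Proof.
  intros Hh [s [Hans Hat]]. exists (fun x => h (s x)). split.
  - rewrite <- (map_map s h), Hans, map_map.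
    apply map_ext, (hom_ind _ _ _ Hh).
  - eapply Forall_impl; [|exact Hat]. intros [A z | R z z']; simpl.
    + apply (hom_con _ _ _ Hh).
    + apply (hom_role _ _ _ Hh).
Qed.

Definition prod_interp (I J : interp) : interp := {|
  dom := dom I * dom J;
  iind := fun a => (iind I a, iind J a);
  iind_inj := fun a b E => iind_inj I a b (f_equal fst E);
  icon := fun A d => icon I A (fst d) /\ icon J A (snd d);
  irole := fun R d e => irole I R (fst d) (fst e) /\ irole J R (snd d) (snd e)
|}.

Lemma homomorphism_fst (I J : interp) : homomorphism (prod_interp I J) I fst.
Proof. split; simpl; tauto. Qed.

Lemma homomorphism_snd (I J : interp) : homomorphism (prod_interp I J) J snd.
Proof. split; simpl; tauto. Qed.

Lemma ext_prod_interp (I J : interp) (C : concept) :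
  (forall D, ~ occurs (CNot D) Neg C) ->
  forall d, ext I C (fst d) -> ext J C (snd d) -> ext (prod_interp I J) C d.
Proof.
  induction C as [A | | C _ | C1 IH1 C2 IH2 | R C IH]; simpl; intros HC d.
  - now split.
  - trivial.
  (* A pair in [C] would project to [I] and contradict [HI]. The projection applies because a
     positive negation inside [C] would occur negatively in [CNot C]. *)
  - intros HI _ HP. apply HI.
    apply (hom_ext_negation_free _ _ _ C (homomorphism_fst I J)); [|assumption].
    intros D HD. apply (HC D). exact (occurs_not _ Pos _ HD).
  - intros [HI1 HI2] [HJ1 HJ2]. split.
    + apply IH1; try assumption. intros D HD. apply (HC D). now constructor.
    + apply IH2; try assumption. intros D HD. apply (HC D). now constructor.
  - intros [e [He HCe]] [f [Hf HCf]]. exists (e, f). split; [now split|].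
    apply IH; try assumption. intros D HD. apply (HC D). now constructor.
Qed.

Lemma model_prod_interp (I J : interp) (K : kb) :
  horn (kb_tbox K) -> model I K -> model J K -> model (prod_interp I J) K.
Proof.
  intros [Hneg _] [HTI HAI] [HTJ HAJ].
  rewrite Forall_forall in HTI, HAI, HTJ, HAJ.
  split; apply Forall_forall.
  - intros i Hi d Hd.
    (* Left-hand sides reverse polarity, so a positive negation here would be a negative one in the
       TBox. *)
    assert (Hlhs : forall D, ~ occurs (CNot D) Pos (lhs i)).
    { intros D HD. apply (Hneg D). exists i. split; [assumption | now left]. }
    apply ext_prod_interp.
    + intros D HD. apply (Hneg D). exists i. split; [assumption | now right].
    + apply (HTI i Hi).
      exact (hom_ext_negation_free _ _ _ _ (homomorphism_fst I J) Hlhs d Hd).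
    + apply (HTJ i Hi).
      exact (hom_ext_negation_free _ _ _ _ (homomorphism_snd I J) Hlhs d Hd).
  - intros s Hs. specialize (HAI s Hs). specialize (HAJ s Hs).
    destruct s; now split.
Qed.

Lemma common_countermodel (K : kb) (ps : list cq) (a : list iname) :
  consistent K -> horn (kb_tbox K) ->
  Forall (fun p => exists I, model I K /\ ~ cq_holds I p a) ps ->
  exists I, model I K /\ Forall (fun p => ~ cq_holds I p a) ps.
Proof.
  intros [I0 HI0] Hhorn Hps.
  induction Hps as [| p ps [I [HI Hp]] _ [J [HJ Hps]]].
  (* The iterated product starts from an arbitrary model, supplied by consistency. *)
  - exists I0. now split.
  - exists (prod_interp I J). split; [now apply model_prod_interp|].
    constructor.
    + intros H. apply Hp. exact (hom_cq_holds _ _ _ _ _ (homomorphism_fst I J) H).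
    + eapply Forall_impl; [|exact Hps]. intros r Hr H. apply Hr.
      exact (hom_cq_holds _ _ _ _ _ (homomorphism_snd I J) H).
Qed.

(** Convexity: the disjunct satisfied in a model may a priori vary with the model; merging
    countermodels, by contradiction, makes the choice uniform. *)
Lemma horn_certain_disjunct (K : kb) (q : ucq) (a : list iname) :
  consistent K -> horn (kb_tbox K) -> certain class_UCQ K q a ->
  exists p, In p (disjuncts q) /\ certain class_CQ K p a.
Proof.
  intros HK Hhorn Hq. apply NNPP. intros Hno.
  destruct (common_countermodel K (disjuncts q) a HK Hhorn) as [I [HI Hps]].
  - apply Forall_forall. intros p Hp. apply NNPP. intros Hp'. apply Hno.
    exists p. split; [assumption|]. intros I HI.
    apply NNPP. intros HIp. apply Hp'. now exists I.
  - apply Forall_Exists_neg in Hps. exact (Hps (Hq I HI)).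
Qed.

Definition singleton_ucq (q : cq) : ucq := UCQ (ans_vars q) [q].

Lemma wf_singleton_ucq (q : cq) : wf_cq q -> wf_ucq (singleton_ucq q).
Proof. intros Hq. split; [discriminate | now apply Forall_cons]. Qed.

Lemma singleton_ucq_over (S : signature) (q : cq) :
  cq_over S q -> ucq_over S (singleton_ucq q).
Proof. intros Hq. now apply Forall_cons. Qed.

Lemma singleton_ucq_holds (I : interp) (q : cq) (a : list iname) :
  ucq_holds I (singleton_ucq q) a <-> cq_holds I q a.
Proof.
  split.
  - intros H. apply Exists_cons in H as [H | H]; [assumption | inversion H].
  - intros H. now constructor.
Qed.

(** The parameter [P] lets one argument cover the plain classes (constantly true) and the rooted
    ones ([rooted]). *)
Definition cq_class (P : cq -> Prop) : query_class :=
  QueryClass cq (fun q => wf_cq q /\ P q) cq_over ans_vars cq_holds.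

Definition ucq_class (P : cq -> Prop) : query_class :=
  QueryClass ucq (fun q => wf_ucq q /\ Forall P (disjuncts q))
             ucq_over uans_vars ucq_holds.

(** A CQ is a one-disjunct UCQ. Conversely, a disjunct certain over [K2] is itself an admissible
    query, and its certainty over [K1] yields that of the whole UCQ. *)
Lemma kb_entails_ucq_iff_cq (P : cq -> Prop) (S : signature) (K1 K2 : kb) :
  consistent K2 -> horn (kb_tbox K2) ->
  kb_entails (ucq_class P) S K1 K2 <-> kb_entails (cq_class P) S K1 K2.
Proof.
  intros HK2 Hhorn. split; intros HE q a.
  - intros [Hwf HP] Hover Hlen Hincl Hcert.
    destruct (HE (singleton_ucq q) a) as [Hincl1 Hcert1]; try assumption.
    + split; [now apply wf_singleton_ucq | now apply Forall_cons].
    + now apply singleton_ucq_over.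
    + intros I HI. now apply singleton_ucq_holds, Hcert.
    + split; [assumption|]. intros I HI. now apply singleton_ucq_holds, Hcert1.
  - intros [[_ Hwf] HP] Hover Hlen Hincl Hcert.
    destruct (horn_certain_disjunct K2 q a HK2 Hhorn Hcert) as [p [Hp Hpcert]].
    simpl in Hover, Hlen. unfold ucq_over in Hover.
    rewrite Forall_forall in Hwf, HP, Hover.
    destruct (Hwf p Hp) as [Hpwf Hpans].
    destruct (HE p a) as [Hincl1 Hcert1]; try assumption.
    + split; [assumption | now apply HP].
    + now apply Hover.
    (* The tuple length is measured against the answer variables that all disjuncts share. *)
    + simpl. now rewrite Hpans.
    + split; [assumption|]. intros I HI. apply Exists_exists.
      exists p. split; [assumption | now apply Hcert1].
Qed.

(** Serves to remove the trivial conjunct left by instantiating [P] with the true predicate. *)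
Lemma kb_entails_class_iff (X : Type) (c c' : X -> Prop) over ans holds
    (S : signature) (K1 K2 : kb) :
  (forall q, c q <-> c' q) ->
  kb_entails (QueryClass X c over ans holds) S K1 K2 <->
  kb_entails (QueryClass X c' over ans holds) S K1 K2.
Proof. intros Hc. split; intros HE q a Hq; apply HE, Hc, Hq. Qed.

Lemma kb_entails_UCQ_iff_CQ (S : signature) (K1 K2 : kb) :
  consistent K2 -> horn (kb_tbox K2) ->
  kb_entails class_UCQ S K1 K2 <-> kb_entails class_CQ S K1 K2.
Proof.
  intros HK2 Hhorn.
  pose proof (kb_entails_ucq_iff_cq (fun _ => True) S K1 K2 HK2 Hhorn) as H.
  etransitivity; [| etransitivity; [exact H|]]; apply kb_entails_class_iff.
  - intros q. split; [|tauto]. intros Hq. split; [assumption|].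
    now apply Forall_forall.
  - tauto.
Qed.

(** Since [urooted] unfolds to [Forall rooted], both classes are convertible to the instances at
    [rooted]. *)
Lemma kb_entails_rUCQ_iff_rCQ (S : signature) (K1 K2 : kb) :
  consistent K2 -> horn (kb_tbox K2) ->
  kb_entails class_rUCQ S K1 K2 <-> kb_entails class_rCQ S K1 K2.
Proof. exact (kb_entails_ucq_iff_cq rooted S K1 K2). Qed.

(** TBox entailment ranges only over ABoxes consistent with [T2], so the knowledge base result can
    be applied to each ABox separately. *)
Lemma tbox_entails_iff (Q Q' : query_class) (S1 S2 : signature) (T1 T2 : tbox) :
  (forall A, consistent (KB T2 A) ->
     kb_entails Q S2 (KB T1 A) (KB T2 A) <-> kb_entails Q' S2 (KB T1 A) (KB T2 A)) ->
  tbox_entails Q S1 S2 T1 T2 <-> tbox_entails Q' S1 S2 T1 T2.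
Proof.
  intros H. split; intros HE A HA H1 H2; apply (H A H2); now apply HE.
Qed.

Theorem theorem1 :
  (forall (K1 K2 : kb) (S : signature),
     consistent K1 -> consistent K2 -> horn (kb_tbox K2) ->
     (kb_entails class_UCQ S K1 K2 <-> kb_entails class_CQ S K1 K2) /\
     (kb_entails class_rUCQ S K1 K2 <-> kb_entails class_rCQ S K1 K2)) /\
  (forall (T1 T2 : tbox) (S1 S2 : signature),
     horn T2 ->
     (tbox_entails class_UCQ S1 S2 T1 T2 <-> tbox_entails class_CQ S1 S2 T1 T2) /\
     (tbox_entails class_rUCQ S1 S2 T1 T2 <-> tbox_entails class_rCQ S1 S2 T1 T2)).
Proof.
  split.
  - intros K1 K2 S _ HK2 Hhorn. split.
    + now apply kb_entails_UCQ_iff_CQ.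
    + now apply kb_entails_rUCQ_iff_rCQ.
  - intros T1 T2 S1 S2 Hhorn. split; apply tbox_entails_iff; intros A HA.
    + now apply kb_entails_UCQ_iff_CQ.
    + now apply kb_entails_rUCQ_iff_rCQ.
Qed.
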